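(* Let $f:[0,1]\to\mathbb{R}$ be a smooth function which is flat at $x=0$. For each integer $n\geq 0$ put $Z(n)=\{x\in(0,1)\mid f^{(n)}(x)=0\}$ and let $z(n)=\sharp Z(n)$ be the number of elements of $Z(n)$. Then $$\lim_{n\to\infty} z(n)=\infty .$$
   Context: A smooth function means a function of class $C^\infty$ on the closed interval $[0,1]$ (one-sided derivatives at the endpoints). $f^{(n)}$ denotes the $n$-th derivative, with $f^{(0)}=f$. A smooth function $f$ on $[0,1]$ is flat at $0$ if $f^{(n)}(x)\to 0$ as $x\to 0+0$ for every integer $n\ge 0$ (equivalently, $f^{(n)}(0)=0$ for every $n\geq 0$). The set $Z(n)$ is allowed to be infinite (possibly uncountable, with the cardinality of the continuum). The limit statement means: for every $M\in\mathbb{N}$ there is $N\in\mathbb{N}$ such that for all $n\geq N$ the set $Z(n)$ is infinite or has at least $M$ elements. *)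

(* Defs.v *)
(* MathComp-Analysis; the real numbers are an arbitrary [R : realType]. *)
From HB Require Import structures.
From mathcomp Require Import all_boot all_order all_algebra.
From mathcomp Require Import all_classical all_reals all_analysis.

Set Implicit Arguments.
Unset Strict Implicit.
Unset Printing Implicit Defensive.

Import Order.TTheory GRing.Theory Num.Theory.
Import numFieldNormedType.Exports.

Local Open Scope classical_set_scope.
Local Open Scope ring_scope.

(* A function on [0, 1] is represented by a total function [f : R -> R] whose
   values outside [0, 1] are irrelevant: the difference quotients below only
   use points of [A], so that with [A = `[0, 1]] the derivative is two-sided
   inside and one-sided at the endpoints.  At points outside [A] the values of
   [derive1_within A f] are meaningless and never used. *)
Definition derivable1_within (R : realType) (A : set R) (f : R -> R) (x : R) :
    Prop :=
  cvg ((f y - f x) / (y - x) @[y --> within A x^']).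

Definition derive1_within (R : realType) (A : set R) (f : R -> R) (x : R) : R :=
  lim ((f y - f x) / (y - x) @[y --> within A x^']).

Definition derive1n_within (R : realType) (A : set R) (n : nat) (f : R -> R) :
    R -> R :=
  iter n (derive1_within A) f.

Definition smooth_on (R : realType) (A : set R) (f : R -> R) : Prop :=
  forall (n : nat) (x : R), A x ->
    derivable1_within A (derive1n_within A n f) x.

Definition flat_at0 (R : realType) (f : R -> R) : Prop :=
  forall n : nat, derive1n_within `[0, 1] n f x @[x --> 0^'+] --> 0.

Definition Z (R : realType) (f : R -> R) (n : nat) : set R :=
  [set x : R | 0 < x < 1 /\ derive1n_within `[0, 1] n f x = 0].

(* [counting A] is the number of elements of [A] if [A] is finite, and [+oo]
   for every infinite [A], countable or not. *)
Definition z (R : realType) (f : R -> R) (n : nat) : \bar R := counting (Z f n).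

(* Main.v *)
Require Import Defs.
From HB Require Import structures.
From mathcomp Require Import all_boot all_order all_algebra.
From mathcomp Require Import all_classical all_reals all_analysis.
From mathcomp Require Import ring lra zify.

Set Implicit Arguments.
Unset Strict Implicit.
Unset Printing Implicit Defensive.

Import Order.TTheory GRing.Theory Num.Theory.
Import numFieldNormedType.Exports.

Local Open Scope classical_set_scope.
Local Open Scope ring_scope.

(** The theorem is proved by contradiction.  If [z f n] does not tend to
    infinity, then for a fixed [k] there are arbitrarily large [n] for which
    f^(n) has at most [k] zeros in (0, 1), hence changes sign at most [k]
    times there.  One then multiplies f^(n) by a polynomial q of degree
    exactly [k], monic up to sign, all of whose roots lie in [0, 1), that
    makes the product nonnegative on (0, 1) ([sign_poly]).

    Put n = N + k.  Since f is flat at 0, repeated integration by parts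
    computes the N-fold antiderivative of q f^(n) vanishing at 0:
      H_N(x) = sum_(j <= k) (-1)^j C(N-1+j, j) q^(j)(x) f^(k-j)(x)
    (this is Leibniz' formula for the derivative of order -N).  Two
    observations are played against each other.

    - H_N is an N-fold antiderivative of a nonnegative function, so it is
      nonnegative and H_N (l y) <= l^(N-1) H_N(y) for 0 < l < 1
      ([antiderivative_growth]): between two given points it shrinks
      exponentially fast in N.
    - In the explicit formula the derivatives of q are bounded in terms of k
      alone, so H_N(y) has at most the size of C(N-1+k, k), polynomial in N,
      while the summand j = k, which is a nonzero constant times
      C(N-1+k, k) f(x), dominates all the others by a factor of order N.

    Dividing by C(N-1+k, k) and letting N tend to infinity gives f(x) = 0
    ([few_signs_bound], [flat_few_signs_eq0]).  As x is arbitrary in (0, 1),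
    f and all its derivatives vanish on (0, 1), so that every Z(n) is
    infinite, against the choice of the n. *)

(** * Derivatives on an open interval *)

Section Calculus.
Context {R : realType}.
Implicit Types (f F : R -> R) (x y a b : R).

(** At an interior point the restriction to [0, 1] does not change the filter
    along which the difference quotients are taken. *)
Lemma is_derive_within01 f x : 0 < x < 1 ->
  derivable1_within `[0, 1] f x ->
  is_derive x 1 f (derive1_within `[0, 1] f x).
Proof.
move=> /andP[x0 x1] df.
(* The radius keeps both [h] in the given ball and [h + x] in [0, 1]. *)
have shift_within : h + x @[h --> (0 : R)^'] --> within `[0, 1] x^'.
  move=> B /= [e /= e0 eB].
  have d0 : 0 < Num.min e (Num.min x (1 - x)).
    by rewrite !lt_min e0 x0 /= subr_gt0.
  exists (Num.min e (Num.min x (1 - x))) => //= h /=.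
  rewrite sub0r normrN !lt_min => /and3P[he hx h1] hN0.
  apply: eB => /=.
  - by rewrite opprD addrCA subrr addr0 normrN.
  - by apply: contra_neq hN0 => hxx; apply: (addIr x); rewrite add0r.
  - by move: hx h1; rewrite !ltr_norml in_itv /= => /andP[? ?] /andP[? ?]; lra.
have qE : (fun h => h^-1 *: ((f \o shift x) (h *: (1 : R)) - f x)) =
    (fun y => (f y - f x) / (y - x)) \o (fun h => h + x).
  apply/funext => h /=; rewrite addrK mulrC.
  by rewrite -[h *: 1]/(h * 1) mulr1.
have cv : h^-1 *: ((f \o shift x) (h *: (1 : R)) - f x) @[h --> 0^'] -->
    derive1_within `[0, 1] f x.
  by rewrite qE; apply: cvg_comp shift_within df.
apply: DeriveDef; first by apply/cvg_ex; exists (derive1_within `[0, 1] f x).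
exact: cvg_lim cv.
Qed.

Lemma continuous_of_is_derive F F' a b x y :
  (forall t, a < t < b -> is_derive t 1 F (F' t)) ->
  a < x -> y < b -> {within `[x, y], continuous F}.
Proof.
move=> dF ax yb; apply: derivable_within_continuous => t.
rewrite in_itv /= => /andP[xt ty].
by case: (dF t) => //; rewrite (lt_le_trans ax xt) (le_lt_trans ty yb).
Qed.

Lemma ndecr_of_derive_ge0 F F' a b x y :
  (forall t, a < t < b -> is_derive t 1 F (F' t)) ->
  (forall t, a < t < b -> 0 <= F' t) ->
  a < x -> x <= y -> y < b -> F x <= F y.
Proof.
move=> dF F'0 ax xy yb.
have inab t : t \in `]x, y[ -> a < t < b.
  by rewrite in_itv /= => /andP[xt ty]; rewrite (lt_trans ax xt) (lt_trans ty yb).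
have [||c cxy FE] := @MVT_segment _ F F' x y xy.
- by move=> t /inab; apply: dF.
- exact: continuous_of_is_derive dF ax yb.
rewrite -subr_ge0 FE mulr_ge0 ?subr_ge0 //.
apply: F'0; move: cxy; rewrite in_itv /= => /andP[xc cy].
by rewrite (lt_le_trans ax xc) (le_lt_trans cy yb).
Qed.

Lemma ge0_of_derive_ge0 F F' a b :
  (forall t, a < t < b -> is_derive t 1 F (F' t)) ->
  (forall t, a < t < b -> 0 <= F' t) ->
  F t @[t --> a^'+] --> 0 ->
  forall x, a < x < b -> 0 <= F x.
Proof.
move=> dF F'0 F0 x /andP[ax xb].
rewrite -(cvg_lim _ F0) //; apply: limr_le; first by apply/cvg_ex; exists 0.
near=> t; apply: (ndecr_of_derive_ge0 dF F'0) => //; near: t.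
exact: nbhs_right_le.
Unshelve. all: end_near. Qed.

End Calculus.

(** * Polynomials compensating sign changes *)

Section Signs.
Context {R : realType}.
Implicit Types (g : R -> R) (s r : seq R).

Definition prodX (s : seq R) : {poly R} := \prod_(a <- s) ('X - a%:P).

Lemma ge0_or_le0_of_pairs g a b :
  (forall x y, a < x -> x < y -> y < b -> 0 <= g x * g y) ->
  (forall x, a < x < b -> 0 <= g x) \/ (forall x, a < x < b -> g x <= 0).
Proof.
move=> gg.
have gg' x y : a < x < b -> a < y < b -> 0 <= g x * g y.
  move=> /andP[ax xb] /andP[ay yb]; have [xy|yx|<-] := ltgtP x y.
  - exact: gg.
  - by rewrite mulrC; apply: gg.
  - by rewrite -expr2 sqr_ge0.
have [[x xab gx]|no] := pselect (exists2 x, a < x < b & 0 < g x).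
  by left=> y yab; rewrite -(pmulr_rge0 _ gx) gg'.
by right=> x xab; rewrite leNgt; apply/negP => gx; apply: no; exists x.
Qed.

Lemma prodX_nil : prodX [::] = 1. Proof. exact: big_nil. Qed.
Lemma prodX_cons a s : prodX (a :: s) = ('X - a%:P) * prodX s.
Proof. exact: big_cons. Qed.

Lemma prodX_cons_horner a s x : (prodX (a :: s)).[x] = (x - a) * (prodX s).[x].
Proof. by rewrite prodX_cons hornerM hornerXsubC. Qed.

(** If no root of the polynomial separates [x] from [y], each linear factor has
    the same sign at both points. *)
Lemma prodX_sign s x y :
  (forall a, a \in s -> a <= x /\ a <= y \/ x <= a /\ y <= a) ->
  0 <= (prodX s).[x] * (prodX s).[y].
Proof.
elim: s => [|a s IH] H; first by rewrite prodX_nil !hornerC mulr1 ler01.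
rewrite !prodX_cons_horner mulrACA mulr_ge0 //.
  case: (H a (mem_head _ _)) => -[ax ay].
    by rewrite mulr_ge0 // subr_ge0.
  by rewrite mulr_le0 // subr_le0.
by apply: IH => b bs; apply: H; rewrite in_cons bs orbT.
Qed.

(** Induction on the zeros [c :: r], from left to right, with the left end [a]
    of the interval moving to [c].  Once the sign is right on (c, 1), it is
    constant on (a, c), because neither [g] nor the product changes sign there;
    adding the root [c] repairs the sign on (a, c) if it is wrong, and
    otherwise a root 0, harmless on the positive axis, is added so that the
    degree is the same in both cases. *)
Lemma sorted_sign_poly g a r : 0 <= a ->
  sorted <=%R r -> {in r, forall c, a <= c < 1 /\ g c = 0} ->
  (forall x y, a < x -> x < y -> y < 1 -> g x * g y < 0 ->
     exists2 c, c \in r & x <= c <= y) ->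
  exists s : seq R, exists e : R,
    [/\ size s = size r, {in s, forall c, c = 0 \/ a <= c < 1}, `|e| = 1 &
        forall x, a < x < 1 -> 0 <= e * g x * (prodX s).[x]].
Proof.
elim: r a => [|c r IH] a a0 r_sorted r_zero r_change.
  have [x y ax xy y1|gge0|gle0] := @ge0_or_le0_of_pairs g a 1.
  - by rewrite leNgt; apply/negP => /(r_change _ _ ax xy y1) [].
  - exists [::], 1; split=> //; first by rewrite normr1.
    by move=> x /gge0; rewrite prodX_nil hornerC mul1r mulr1.
  - exists [::], (-1); split=> //; first by rewrite normrN1.
    by move=> x /gle0; rewrite prodX_nil hornerC mulN1r mulr1 oppr_ge0.
have [/andP[ac c1] gc0] := r_zero c (mem_head _ _).
have c_min d : d \in r -> c <= d.
  by move: r_sorted; rewrite /= (path_sortedE le_trans) => /andP[/allP + _]; apply.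
have c0 := le_trans a0 ac.
have [|d dr||s [e [sz sin e1 esign]]] := IH c c0.
- exact: path_sorted r_sorted.
- have [/andP[_ d1] gd0] : a <= d < 1 /\ g d = 0.
    by apply: r_zero; rewrite in_cons dr orbT.
  by rewrite c_min.
- move=> x y cx xy y1 /(r_change _ _ (le_lt_trans ac cx) xy y1) [d + /andP[xd dy]].
  rewrite in_cons => /orP[/eqP dc|dr]; last by exists d; rewrite ?xd.
  by move: xd; rewrite dc leNgt cx.
have hin x y : a < x -> x < y -> y < c ->
    0 <= (e * g x * (prodX s).[x]) * (e * g y * (prodX s).[y]).
  move=> ax xy yc; rewrite [_ * _ * _ * _]mulrACA mulr_ge0 //; last first.
    apply: prodX_sign => d /sin [->|/andP[cd _]]; [left|right].
      by have := le_lt_trans a0 ax; split; apply: ltW => //; apply: lt_trans xy.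
    by split; apply/ltW/(lt_le_trans _ cd) => //; apply: lt_trans yc.
  rewrite mulrACA -expr2 mulr_ge0 ?sqr_ge0 // leNgt; apply/negP.
  move=> /(r_change _ _ ax xy (lt_trans yc c1)) [d + /andP[_ dy]].
  rewrite in_cons => /orP[/eqP|/c_min] => [dc|cd].
    by move: dy; rewrite dc leNgt yc.
  by have := lt_le_trans yc (le_trans cd dy); rewrite ltxx.
have sin' b : b = 0 \/ a <= b < 1 -> {in b :: s, forall d, d = 0 \/ a <= d < 1}.
  move=> hb d; rewrite in_cons => /orP[/eqP->//|/sin[|/andP[cd d1]]]; first by left.
  by right; rewrite (le_trans ac cd).
have [sge0|sle0] := ge0_or_le0_of_pairs hin.
- exists (0 :: s), e; split=> //=; [by rewrite sz|by apply: sin'; left|].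
  move=> x /andP[ax x1]; rewrite prodX_cons_horner subr0 mulrCA.
  rewrite mulr_ge0 ?(le_trans a0 (ltW ax)) //.
  have [xc|cx|->] := ltgtP x c; last by rewrite gc0 mulr0 mul0r.
    by apply: sge0; rewrite ax.
  by apply: esign; rewrite cx.
- exists (c :: s), e; split=> //=; [by rewrite sz|by apply: sin'; right; rewrite ac|].
  move=> x /andP[ax x1]; rewrite prodX_cons_horner mulrCA.
  have [xc|cx|->] := ltgtP x c; last by rewrite subrr mul0r.
    by rewrite mulr_le0 ?subr_le0 ?(ltW xc) // sle0 // ax.
  by rewrite mulr_ge0 ?subr_ge0 ?(ltW cx) // esign // cx.
Qed.

(** Here the sign changes are located by the intermediate value theorem, and the
    degree is raised to exactly [k] with roots 0, so that it does not depend
    on the number of zeros. *)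
Lemma sign_poly g r k : (size r <= k)%N ->
  (forall x y, 0 < x -> y < 1 -> {within `[x, y], continuous g}) ->
  (forall x, x \in r <-> 0 < x < 1 /\ g x = 0) ->
  exists s : seq R, exists e : R,
    [/\ size s = k, {in s, forall c, 0 <= c < 1}, `|e| = 1 &
        forall x, 0 < x < 1 -> 0 <= e * g x * (prodX s).[x]].
Proof.
move=> rk g_cont rE.
have [|||s [e [sz sin e1 esign]]] := @sorted_sign_poly g 0 (sort <=%R r) (lexx 0).
- exact/sort_sorted/le_total.
- move=> c; rewrite mem_sort => /rE [/andP[c0 c1] gc]; rewrite (ltW c0).
  by rewrite c1.
- move=> x y x0 xy y1 gxy.
  have [|c] := @IVT R g x y 0 (ltW xy) (g_cont x y x0 y1).
    rewrite ge_min le_max; move: gxy.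
    have [gx|gx|->] := ltgtP (g x) 0; last by rewrite mul0r ltxx.
      by rewrite nmulr_rlt0 // => /ltW ->.
    by rewrite pmulr_rlt0 // => /ltW ->.
  rewrite in_itv /= => cxy gc; exists c => //; rewrite mem_sort; apply/rE.
  by case/andP: cxy => xc cy; rewrite (lt_le_trans x0 xc) (le_lt_trans cy y1).
exists (nseq (k - size r) 0 ++ s), e; split=> //.
- by rewrite size_cat size_nseq sz size_sort subnK.
- move=> c; rewrite mem_cat mem_nseq => /orP[/andP[_ /eqP->]|/sin [->|//]];
  by rewrite lexx ltr01.
- move=> x x01; elim: (k - _)%N => [|n IH]; first exact: esign.
  rewrite /= prodX_cons_horner subr0 mulrCA mulr_ge0 //.
  by case/andP: x01 => /ltW.
Qed.

End Signs.

(** * Iterated antiderivatives of a nonnegative function *)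

Section Growth.
Context {R : realType}.
Implicit Types (H : nat -> R -> R) (x l : R).

Lemma antiderivative_ge0 H N :
  (forall p x, (p < N)%N -> 0 < x < 1 -> is_derive x 1 (H p.+1) (H p x)) ->
  (forall x, 0 < x < 1 -> 0 <= H 0 x) ->
  (forall p, (p <= N)%N -> H p t @[t --> 0^'+] --> 0) ->
  forall p x, (p <= N)%N -> 0 < x < 1 -> 0 <= H p x.
Proof.
move=> dH H0 Hlim; elim=> [|p IH] x pN x01; first exact: H0.
apply: (ge0_of_derive_ge0 _ _ (Hlim _ pN) x01) => t t01.
- exact: dH.
- by apply: IH => //; apply: ltnW.
Qed.

(** The extremal case is H_(p+1)(x) = x^p / p!.  In general, the function
    G(t) = l^(p+1) H_(p+2)(t) - H_(p+2)(l t) tends to 0 at 0 and its derivative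
    is l times the nonnegative difference given by the previous order; so G is
    nonnegative.  The induction starts with H_1 nondecreasing. *)
Lemma antiderivative_growth H N :
  (forall p x, (p < N)%N -> 0 < x < 1 -> is_derive x 1 (H p.+1) (H p x)) ->
  (forall x, 0 < x < 1 -> 0 <= H 0 x) ->
  (forall p, (p <= N)%N -> H p t @[t --> 0^'+] --> 0) ->
  forall l, 0 < l < 1 ->
  forall p x, (p < N)%N -> 0 < x < 1 -> H p.+1 (l * x) <= l ^+ p * H p.+1 x.
Proof.
move=> dH H0 Hlim l /andP[l0 l1].
have lx01 x : 0 < x < 1 -> 0 < l * x < 1.
  by case/andP=> x0 x1; rewrite mulr_gt0 // mulr_ilt1 ?(ltW l0) ?(ltW x0).
elim=> [|p IH] x pN x01.
  have /andP[lx0 lx1] := lx01 x x01; case/andP: (x01) => x0 x1.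
  rewrite expr0 mul1r; apply: (@ndecr_of_derive_ge0 _ (H 1%N) (H 0%N) 0 1) => //.
  - by move=> t; apply: dH.
  - by rewrite ger_pMl // ltW.
pose G t := l ^+ p.+1 * H p.+2 t - H p.+2 (l * t).
pose G' t := l ^+ p.+1 * H p.+1 t - l * H p.+1 (l * t).
rewrite -subr_ge0; apply: (@ge0_of_derive_ge0 _ G G' 0 1 _ _ _ x x01).
- move=> t t01; have d1 := dH _ _ pN t01.
  have d2 : is_derive t 1 (fun u => H p.+2 (l * u)) (H p.+1 (l * t) * l).
    have := @is_derive1_comp _ (H p.+2) (fun u => l * u) t (H p.+1 (l * t)) l.
    apply; first by apply: dH; rewrite ?lx01.
    apply: (is_derive_eq (@is_deriveZ _ _ _ id l t 1 _ (is_derive_id t 1))).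
    exact: mulr1.
  apply: (is_derive_eq (is_deriveB (is_deriveZ (l ^+ p.+1) d1) d2)).
  by rewrite /G' [l * H _ _]mulrC.
- move=> t t01; rewrite /G' exprS -mulrA -mulrBr mulr_ge0 ?(ltW l0) //.
  by rewrite subr_ge0 IH // ltnW.
- have lim_l : l * t @[t --> (0 : R)^'+] --> 0^'+.
    move=> B /= [e /= e0 eB]; exists e => //= t /= te t0.
    apply: eB; last by rewrite mulr_gt0.
    rewrite /= in te *; move: te; rewrite !sub0r !normrN normrM.
    by apply: le_lt_trans; rewrite ger0_norm ?(ltW l0) // ler_piMl // ltW.
  suff : G t @[t --> 0^'+] --> l ^+ p.+1 * 0 - 0 by rewrite mulr0 subr0.
  apply: cvgB; first by apply: cvgM; [exact: cvg_cst|exact: Hlim].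
  exact: (@cvg_comp _ _ _ (fun t => l * t) (H p.+2) _ _ _ lim_l (Hlim p.+2 pN)).
Qed.

End Growth.

(** * Integration by parts against a polynomial *)

Section Leibniz.
Context {R : realType}.
Variables (D : nat -> R -> R) (q : {poly R}) (k n : nat).

(** With D_i = f^(i), this is Leibniz' formula for the derivative of order -p of
    q D_n, since (-1)^j C(p+j-1, j) is the binomial coefficient of -p over j.
    For p = 0 and j = 0 the truncated predecessor gives C(0, 0) = 1, and for
    p = 0 < j it gives C(j-1, j) = 0, as it should. *)
Definition weighted_antiderivative (p : nat) (x : R) : R :=
  \sum_(j < k.+1) ((-1) ^+ j * 'C((p + j).-1, j)%:R) *
    (q^`(j).[x] * D (n - p - j) x).

Lemma weighted_antiderivative0 x : weighted_antiderivative 0 x = q.[x] * D n x.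
Proof.
rewrite /weighted_antiderivative big_ord_recl big1 => [|i _].
  by rewrite /= bin0 expr0 !mul1r addr0 !subn0.
by rewrite lift0 add0n [i.+1.-1]/= bin_small // mulr0 mul0r.
Qed.

(** Differentiating termwise, the coefficient of q^(j) D_(n-p-j) is
    (-1)^j (C(p+j, j) - C(p+j-1, j-1)) = (-1)^j C(p+j-1, j) by Pascal's rule.
    The degree bound on [q] kills the boundary term in q^(k+1), and
    [p + k < n] keeps the subtractions of indices from being truncated. *)
Lemma is_derive_weighted_antiderivative p (x : R) : (size q <= k.+1)%N ->
  (p + k < n)%N -> (forall i, is_derive x 1 (D i) (D i.+1 x)) ->
  is_derive x 1 (weighted_antiderivative p.+1) (weighted_antiderivative p x).
Proof.
move=> qk pn dD.
pose c p j : R := (-1) ^+ j * 'C((p + j).-1, j)%:R.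
have dterm (j : 'I_k.+1) : is_derive x 1
    (fun y => c p.+1 j * (q^`(j).[y] * D (n - p.+1 - j) y))
    (c p.+1 j * (q^`(j.+1).[x] * D (n - p.+1 - j) x + q^`(j).[x] * D (n - p - j) x)).
  have h := is_deriveZ (c p.+1 j)
    (is_deriveM (is_derive_poly q^`(j) x) (dD (n - p.+1 - j)%N)).
  apply: (is_derive_eq h).
  have -> : (n - p - j = (n - p.+1 - j).+1)%N by have := ltn_ord j; lia.
  rewrite -derivnS.
  by rewrite -![_ *: _]/(_ * _) addrC [D _ _ * _]mulrC.
have := is_derive_sum dterm.
rewrite fct_sumE.
move=> h; apply: (is_derive_eq h).
under eq_bigr => j _ do rewrite mulrDr.
rewrite big_split big_ord_recr derivn_poly0 // horner0 mul0r mulr0 [LHS]/=.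
rewrite addr0 (@big_ord_recl _ _ _ k) addrCA -big_split.
rewrite /weighted_antiderivative big_ord_recl /= /c !bin0; congr (_ + _).
apply: eq_bigr => j _; rewrite /bump /= add1n.
have -> : (n - p.+1 - j = n - p - j.+1)%N by lia.
rewrite -mulrDl; congr (_ * _); rewrite !addnS /= binS natrD.
by rewrite exprS; ring.
Qed.

End Leibniz.

(** * Derivatives of a product of linear factors *)

Section DerivBounds.
Context {R : realType}.

Lemma derivn_mulXsubC (a : R) (q : {poly R}) j :
  (('X - a%:P) * q)^`(j.+1) = ('X - a%:P) * q^`(j.+1) + q^`(j) *+ j.+1.
Proof.
elim: j => [|j IH].
  by rewrite derivn1 derivM derivXsubC mul1r derivn0 addrC derivn1 mulr1n.
rewrite derivnS IH derivD derivM derivXsubC mul1r derivMn -!derivnS.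
by rewrite [X in X + _ = _]addrC -addrA -mulrS.
Qed.

Lemma size_prodX (s : seq R) : size (prodX s) = (size s).+1.
Proof. exact: size_prod_XsubC. Qed.

Lemma derivn_prodX (s : seq R) : (prodX s)^`(size s) = ((size s)`!%:R)%:P.
Proof.
elim: s => [|a s IH]; first by rewrite prodX_nil derivn0.
rewrite prodX_cons derivn_mulXsubC IH derivn_poly0 ?size_prodX // mulr0 add0r.
by rewrite -polyCMn factS natrM mulr_natl.
Qed.

(** The bound depends only on the number of roots: a new factor [X - a] turns
    q^(j) into (x - a) q^(j) + j q^(j-1), which multiplies the bound by at most
    1 + j; and j is at most the number of roots unless the second term is 0. *)
Lemma derivn_prodX_bound (s : seq R) (x : R) j : 0 <= x <= 1 ->
  {in s, forall a, 0 <= a <= 1} -> `|(prodX s)^`(j).[x]| <= ((size s).+1`!)%:R.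
Proof.
move=> /andP[x0 x1]; elim: s j => [|a s IH] j s01.
  rewrite prodX_nil; case: j => [|j]; first by rewrite derivn0 hornerC normr1.
  by rewrite derivn_poly0 ?size_poly1 // horner0 normr0.
have /andP[a0 a1] := s01 a (mem_head _ _).
have {}IH i : `|(prodX s)^`(i).[x]| <= ((size s).+1`!)%:R.
  by apply: IH => b bs; apply: s01; rewrite in_cons bs orbT.
have xa : `|x - a| <= 1 by rewrite ler_norml; lra.
have mul_le i : `|(x - a) * (prodX s)^`(i).[x]| <= ((size s).+1`!)%:R.
  by rewrite normrM (le_trans _ (IH i)) // ler_piMl.
rewrite /= factS natrM mulr_natl prodX_cons; case: j => [|j].
  rewrite derivn0 hornerM hornerXsubC; apply: le_trans (mul_le 0) _.
  by rewrite -[leLHS]mulr1n ler_wpMn2l // ler0n.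
rewrite derivn_mulXsubC hornerD hornerM hornerXsubC hornerMn [leRHS]mulrS.
apply: le_trans (ler_normD _ _) (lerD (mul_le _) _).
have [sj|js] := ltnP (size s) j.
  by rewrite derivn_poly0 ?size_prodX // horner0 mul0rn normr0 mulrn_wge0 // ler0n.
rewrite normrMn; apply: le_trans (ler_wMn2r _ (IH j)) _.
by rewrite ler_wpMn2l ?ler0n.
Qed.

End DerivBounds.

(** * Flat functions with few sign changes vanish *)

Section FlatSequence.
Context {R : realType}.

Lemma leq_binDl m j k : (j <= k)%N -> ('C(m + j, j) <= 'C(m + k, k))%N.
Proof.
move=> jk; rewrite -['C(m + j, j)]bin_sub ?leq_addl // addnK.
by rewrite -['C(m + k, k)]bin_sub ?leq_addl // addnK leq_bin2l // leq_add2l.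
Qed.

Lemma eq0_of_frequently_le (a : R) (u : R ^nat) : u m @[m --> \oo] --> 0 ->
  (forall N, exists2 m, (N <= m)%N & `|a| <= u m) -> a = 0.
Proof.
move=> u0 au; apply/eqP; rewrite -normr_le0 leNgt; apply/negP => a0.
have [N _ Nu] := (cvgr0Pnorm_lt _).1 u0 _ a0.
have [m Nm] := au N; rewrite leNgt => /negP; apply.
exact: le_lt_trans (ler_norm _) (Nu m Nm).
Qed.

(** [D] stands for the sequence of the derivatives of a flat function; only
    its values on (0, 1) matter. *)
Variable D : nat -> R -> R.
Hypothesis D_derive : forall i (x : R), 0 < x < 1 -> is_derive x 1 (D i) (D i.+1 x).
Hypothesis D_flat : forall i, D i t @[t --> 0^'+] --> 0.

Lemma weighted_antiderivative_flat (q : {poly R}) k n p :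
  weighted_antiderivative D q k n p t @[t --> 0^'+] --> 0.
Proof.
suff : weighted_antiderivative D q k n p t @[t --> 0^'+] -->
    \sum_(j < k.+1) ((-1) ^+ j * 'C((p + j).-1, j)%:R) * (q^`(j).[0] * 0).
  by rewrite big1 // => j _; rewrite !mulr0.
apply: cvg_big => [|j _]; first exact: add_continuous.
apply: cvgM; first exact: cvg_cst.
apply: cvgM; last exact: D_flat.
apply: cvg_at_right_filter; exact: continuous_horner.
Qed.

(** Once divided by C(m+k+1, k+1), the explicit formula at [x] is at most this
    quantity, which depends neither on [m] nor on the polynomial. *)
Definition coef_bound (k : nat) (x : R) : R :=
  \sum_(j < k.+2) (k.+2`!)%:R * `|D (k.+1 - j) x|.

(** Solve the explicit formula for the (m+1)-fold antiderivative H_(m+1) at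
    l y for its summand j = k+1, which is a constant times D_0 (l y).  The term
    l^m comes from the growth of H_(m+1) between l y and y; the term in
    [harmonic m] from the other summands, because
    C(m+k, k) = (k+1) / (m+k+1) C(m+k+1, k+1). *)
Lemma few_signs_bound k m (s : seq R) (e l y : R) :
  size s = k.+1 -> {in s, forall c, 0 <= c < 1} -> `|e| = 1 ->
  (forall x, 0 < x < 1 -> 0 <= e * D (m.+1 + k.+1) x * (prodX s).[x]) ->
  0 < l < 1 -> 0 < y < 1 ->
  `|D 0 (l * y)| <=
    (l ^+ m + k.+1%:R * harmonic m) * (coef_bound k (l * y) + coef_bound k y).
Proof.
move=> sk s01 e1 esign l01 y01; set n := (m.+1 + k.+1)%N in esign *.
pose q := e *: prodX s; pose H := weighted_antiderivative D q k.+1 n.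
have ly01 : 0 < l * y < 1.
  case/andP: l01 => l0 l1; case/andP: y01 => y0 y1.
  by rewrite mulr_gt0 // mulr_ilt1 ?ltW.
have size_q : (size q <= k.+2)%N.
  by apply: leq_trans (size_scale_leq _ _) _; rewrite size_prodX sk.
have dH p (x : R) : (p < m.+1)%N -> 0 < x < 1 -> is_derive x 1 (H p.+1) (H p x).
  move=> pm x01; apply: is_derive_weighted_antiderivative => // [|i].
    by rewrite ltn_add2r.
  exact: D_derive.
have H0 x : 0 < x < 1 -> 0 <= H 0%N x.
  move=> x01; rewrite /H weighted_antiderivative0 hornerZ mulrAC.
  exact: esign.
have Hflat p : (p <= m.+1)%N -> H p t @[t --> 0^'+] --> 0.
  by move=> _; apply: weighted_antiderivative_flat.
have Hge0 := antiderivative_ge0 dH H0 Hflat (leqnn _) ly01.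
have Hgrow := antiderivative_growth dH H0 Hflat l01 (leqnn _) y01.
have HE x : H m.+1 x = \sum_(j < k.+2)
    ((-1) ^+ j * 'C(m + j, j)%:R) * (q^`(j).[x] * D (k.+1 - j) x).
  apply: eq_bigr => j _; congr (_ * (_ * D _ _)); rewrite /n; lia.
have q_bound x j : 0 < x < 1 -> `|q^`(j).[x]| <= (k.+2`!)%:R.
  case/andP=> x0 x1; rewrite derivnZ hornerZ normrM e1 mul1r -sk.
  apply: derivn_prodX_bound; first by rewrite !ltW.
  by move=> c /s01 /andP[-> /ltW].
have term_bound x i j : 0 < x < 1 -> (j <= i)%N ->
    `|(-1) ^+ j * 'C(m + j, j)%:R * (q^`(j).[x] * D (k.+1 - j) x)| <=
    'C(m + i, i)%:R * ((k.+2`!)%:R * `|D (k.+1 - j) x|).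
  move=> x01 ji; rewrite !normrM normrX normrN1 expr1n mul1r normr_nat.
  by rewrite ler_pM ?mulr_ge0 // ?ler_nat ?leq_binDl // ler_wpM2r // q_bound.
have H_le : H m.+1 y <= 'C(m + k.+1, k.+1)%:R * coef_bound k y.
  rewrite HE /coef_bound mulr_sumr; apply: ler_sum => j _.
  by apply: le_trans (ler_norm _) (term_bound _ _ _ y01 _); rewrite -ltnS.
have lead : k.+1`!%:R * 'C(m + k.+1, k.+1)%:R * `|D 0%N (l * y)| <=
    H m.+1 (l * y) + 'C(m + k, k)%:R * coef_bound k (l * y).
  pose low := \sum_(j < k.+1)
    ((-1) ^+ j * 'C(m + j, j)%:R) * (q^`(j).[l * y] * D (k.+1 - j) (l * y)).
  have -> : k.+1`!%:R * 'C(m + k.+1, k.+1)%:R * `|D 0%N (l * y)| =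
      `|H m.+1 (l * y) - low|.
    rewrite HE big_ord_recr /= [low + _]addrC addrK subnn -derivnS.
    have -> : q^`(k.+1) = (e * k.+1`!%:R)%:P.
      by rewrite derivnZ -{1}sk derivn_prodX sk -mul_polyC -polyCM.
    rewrite hornerC !normrM normrX normrN1 expr1n e1 !mul1r !normr_nat.
    by rewrite mulrA [X in X * _]mulrC.
  apply: le_trans (ler_normB _ _) _; rewrite ger0_norm // lerD2l.
  rewrite /coef_bound big_ord_recr /= mulrDr ler_wpDr ?mulr_ge0 //.
  apply: le_trans (ler_norm_sum _ _ _) _; rewrite mulr_sumr.
  by apply: ler_sum => j _; apply: term_bound => //; rewrite -ltnS.
set B := 'C(m + k.+1, k.+1)%:R in H_le lead.
have B_gt0 : 0 < B by rewrite ltr0n bin_gt0 leq_addl.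
have coef_ge0 x : 0 <= coef_bound k x.
  by apply: sumr_ge0 => j _; rewrite mulr_ge0.
have low_le : 'C(m + k, k)%:R <= B * (k.+1%:R * harmonic m).
  rewrite /harmonic /= mulrA ler_pdivlMr ?ltr0n // /B -!natrM ler_nat.
  have := mul_bin_diag (m + k.+1) k; rewrite addnS /= => E.
  rewrite [leqRHS]mulnC -E mulnC leq_mul2r; apply/orP; right.
  by rewrite ltnS leq_addr.
rewrite -(ler_pM2l B_gt0).
apply: le_trans (_ : k.+1`!%:R * B * `|D 0%N (l * y)| <= _).
  by rewrite -mulrA ler_peMl ?mulr_ge0 ?(ltW B_gt0) // ler1n fact_gt0.
apply: le_trans lead _.
case/andP: l01 => l0 _; have lm0 : 0 <= l ^+ m by rewrite exprn_ge0 // ltW.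
have u0 : 0 <= k.+1%:R * harmonic m :> R by rewrite mulr_ge0 // invr_ge0.
have h1 : H m.+1 (l * y) <= l ^+ m * (B * coef_bound k y).
  by apply: le_trans Hgrow _; rewrite ler_wpM2l.
have h2 := ler_wpM2r (coef_ge0 (l * y)) low_le.
have := mulr_ge0 (mulr_ge0 (ltW B_gt0) lm0) (coef_ge0 (l * y)).
have := mulr_ge0 (mulr_ge0 (ltW B_gt0) u0) (coef_ge0 y).
move: h1 h2; set u := k.+1%:R * harmonic m; set L := l ^+ m; lra.
Qed.

(** In the previous bound the factor [coef_bound] is fixed while the other one
    tends to 0; [y] is any point with x < y < 1, and the midpoint of [x] and 1
    is chosen. *)
Lemma flat_few_signs_eq0 k :
  (forall N, exists2 n, (N <= n)%N & exists s : seq R, exists e : R,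
    [/\ size s = k.+1, {in s, forall c, 0 <= c < 1}, `|e| = 1 &
        forall x, 0 < x < 1 -> 0 <= e * D n x * (prodX s).[x]]) ->
  forall x, 0 < x < 1 -> D 0 x = 0.
Proof.
move=> signs x /andP[x0 x1].
pose y := (1 + x) / 2; pose l := x / y.
have y01 : 0 < y < 1 by rewrite /y; lra.
have y_gt0 : 0 < y by case/andP: y01.
have l01 : 0 < l < 1.
  by rewrite /l divr_gt0 //= ltr_pdivrMr // mul1r /y; lra.
have xE : x = l * y by rewrite /l divfK // gt_eqF.
pose u (m : nat) : R :=
  (l ^+ m + k.+1%:R * harmonic m) * (coef_bound k x + coef_bound k y).
apply: (@eq0_of_frequently_le _ u).
  suff : u m @[m --> \oo] --> (0 + k.+1%:R * 0) * (coef_bound k x + coef_bound k y).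
    by rewrite mulr0 addr0 mul0r.
  apply: cvgM; last exact: cvg_cst.
  apply: cvgD; last by apply: cvgM; [exact: cvg_cst|exact: cvg_harmonic].
  by apply: cvg_expr; case/andP: l01 => l0 l1; rewrite gtr0_norm.
move=> N; have [n Nn [s [e [sk s01 e1 esign]]]] := signs (N + k.+2)%N.
exists (n - k.+2)%N; first by lia.
rewrite /u xE; apply: few_signs_bound sk s01 e1 _ l01 y01.
by have -> : ((n - k.+2).+1 + k.+1 = n)%N by lia.
Qed.

End FlatSequence.

(** * Divergence of the number of zeros *)

Theorem theorem2 (R : realType) (f : R -> R)
    (f_smooth : smooth_on `[0, 1] f) (f_flat : flat_at0 f) :
  z f n @[n --> \oo] --> +oo%E.
Proof.
pose D n := derive1n_within `[0, 1] n f.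
have D_derive i (x : R) : 0 < x < 1 -> is_derive x 1 (D i) (D i.+1 x).
  move=> x01; apply: is_derive_within01 => //; apply: f_smooth.
  by rewrite /= in_itv /=; case/andP: x01 => /ltW -> /ltW ->.
apply/cvgeyPge => A; apply: contrapT => not_near.
have few N : exists2 n, (N <= n)%N & (z f n < A%:E)%E.
  apply: contrapT => no; apply: not_near; exists N => // n /= Nn.
  by rewrite leNgt; apply/negP => zA; apply: no; exists n.
have f0 x : 0 < x < 1 -> f x = 0.
  apply: (@flat_few_signs_eq0 _ D D_derive f_flat (Num.truncn A)) => N.
  have [n Nn] := few N; rewrite /z /counting; case: asboolP => // Zfin.
  rewrite lte_fin => ZA; exists n => //.
  apply: (@sign_poly _ (D n) (finmap.enum_fset (fset_set (Z f n)))).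
  - apply: ltnW; rewrite -(ltr_nat R); apply: lt_trans ZA _; exact: truncnS_gt.
  - move=> a b a0 b1; apply: (@continuous_of_is_derive _ _ (D n.+1) 0 1) => //.
  - move=> c; have := in_fset_set Zfin c; rewrite /= => ->.
    by rewrite in_setE.
have D0 n x : 0 < x < 1 -> D n x = 0.
  elim: n x => [|n IH] x x01; first exact: f0.
  have [_ <-] := D_derive n x x01; rewrite (@near_eq_derive _ _ _ _ (cst 0)).
    exact: derive_cst.
  case/andP: x01 => x0 x1; near=> t; apply: IH; apply/andP; split; near: t.
    exact: lt_nbhsr.
  exact: lt_nbhsl.
have [n _] := few 0%N; rewrite /z /counting; case: asboolP => // Zfin _.
(* The infinitely many points 1 / (i + 2) are zeros of f^(n) in (0, 1). *)
pose inv2 (i : nat) : R := i.+2%:R^-1.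
apply: infinite_nat; suff <- : inv2 @^-1` Z f n = setT.
  apply: finite_preimage Zfin => i j _ _ /invr_inj /eqP.
  by rewrite eqr_nat => /eqP [].
apply/seteqP; split=> // i _.
have i01 : 0 < inv2 i < 1 by rewrite /inv2 invr_gt0 ltr0n invf_lt1 ?ltr1n ?ltr0n.
by split=> //; apply: D0.
Unshelve. all: end_near. Qed.
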